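(* Let $0<\sigma\le\beta<\infty$ and $\gamma\in(0,\infty)$, and put $$\delta:=\max\left(\frac{\gamma\beta-1}{\gamma\beta+1},\frac{1-\gamma\sigma}{1+\gamma\sigma}\right).$$ Consider the class of problems of minimizing $f+g$ where $f,g$ are proper, closed and convex on a real Hilbert space $\mathcal{H}$ and $f$ is $\sigma$-strongly convex and $\beta$-smooth, and the Douglas–Rachford iteration $z^{k+1}=((1-\alpha)\mathrm{Id}+\alpha R_{\gamma g}R_{\gamma f})z^k$. (1) For every $\alpha\in\left(0,\frac{2}{1+\delta}\right)$, the rate bound $\|z^{k+1}-\bar z\|\le(|1-\alpha|+\alpha\delta)\|z^k-\bar z\|$ (with $\bar z$ a fixed point of $R_{\gamma g}R_{\gamma f}$) is tight for this class: there exist a problem $(\mathcal{H},f,g)$ in the class, a fixed point $\bar z$ of $R_{\gamma g}R_{\gamma f}$ and a starting point $z^0\ne\bar z$ such that $\|z^{k+1}-\bar z\|=(|1-\alpha|+\alpha\delta)\|z^k-\bar z\|$ for all $k\ge 0$. (2) For every real $\alpha\notin\left(0,\frac{2}{1+\delta}\right)$, there exists a problem $(\mathcal{H},f,g)$ in the class that the Douglas–Rachford algorithm does not solve: for some starting point $z^0$ the sequence $x^k=\mathrm{prox}_{\gamma f}(z^k)$ does not converge to a minimizer of $f+g$.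
   Context: For a proper, closed, convex $h:\mathcal{H}\to\mathbb{R}\cup\{\infty\}$ and $\gamma>0$: $\mathrm{prox}_{\gamma h}(z)=\operatorname{argmin}_x\{\gamma h(x)+\frac12\|x-z\|^2\}$ and $R_{\gamma h}=2\,\mathrm{prox}_{\gamma h}-\mathrm{Id}$. $f$ is $\sigma$-strongly convex if $f-\frac{\sigma}{2}\|\cdot\|^2$ is convex, and $\beta$-smooth if it is differentiable and $\frac{\beta}{2}\|\cdot\|^2-f$ is convex. A point $x$ minimizes $f+g$ iff $x=\mathrm{prox}_{\gamma f}(z)$ for some fixed point $z$ of $R_{\gamma g}R_{\gamma f}$. *)

(* Defs.v *)
From HB Require Import structures.
From mathcomp Require Import all_boot all_order all_algebra.
From mathcomp Require Import all_classical all_reals all_analysis.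

Set Implicit Arguments.
Unset Strict Implicit.
Unset Printing Implicit Defensive.

Import Order.TTheory GRing.Theory Num.Theory.
Import numFieldNormedType.Exports.

Local Open Scope classical_set_scope.
Local Open Scope ring_scope.

Record hilbertSpace (R : realType) := HilbertSpace {
  hilbert_space :> completeNormedModType R ;
  hilbert_dot : {dot hilbert_space for (idfun : R -> R)} ;
  hilbert_dot_norm : forall x : hilbert_space, hilbert_dot x x = `|x| ^+ 2 }.

Section ExtendedFunctions.
Context {R : realType} {H : hilbertSpace R}.
Implicit Types h f g : H -> \bar R.

Definition proper h : Prop :=
  (forall x, h x != -oo%E) /\ (exists x, h x != +oo%E).

Definition closed_fun h : Prop :=
  closed [set p : H * R | (h p.1 <= p.2%:E)%E].

(* Since 0 * +oo = 0 in the extended reals, the cases t = 0 and t = 1 hold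
   trivially. *)
Definition convex_fun h : Prop :=
  forall (x y : H) (t : R), 0 <= t <= 1 ->
    (h (t *: x + (1 - t) *: y)%R <= t%:E * h x + (1 - t)%:E * h y)%E.

Definition strongly_convex (sigma : R) f : Prop :=
  convex_fun (fun x => (f x - (sigma / 2 * `|x| ^+ 2)%R%:E)%E).

(* Differentiability is Frechet differentiability of the real-valued function
   that f is required to be. *)
Definition smooth (beta : R) f : Prop :=
  [/\ forall x, f x \is a fin_num,
      forall x : H, differentiable (fine \o f : H -> R^o) x
    & convex_fun (fun x => ((beta / 2 * `|x| ^+ 2)%R%:E - f x)%E)].

Definition minimizer h (x : H) : Prop := forall y, (h x <= h y)%E.

(* [get] picks an element by choice. For h proper, closed and convex and
   gamma > 0 the set of minimizers is a singleton, so this is its element. *)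
Definition prox (gamma : R) h (z : H) : H :=
  get [set x | minimizer
         (fun y => (gamma%:E * h y + (2^-1 * `|y - z| ^+ 2)%R%:E)%E) x].

Definition reflected_prox (gamma : R) h (z : H) : H :=
  2 *: prox gamma h z - z.

Definition dr_class (sigma beta : R) f g : Prop :=
  [/\ [/\ proper f, closed_fun f & convex_fun f],
      [/\ proper g, closed_fun g & convex_fun g],
      strongly_convex sigma f
    & smooth beta f].

Definition pr_operator (gamma : R) f g : H -> H :=
  reflected_prox gamma g \o reflected_prox gamma f.

Definition dr_operator (gamma alpha : R) f g (z : H) : H :=
  (1 - alpha) *: z + alpha *: pr_operator gamma f g z.

Definition dr_iter (gamma alpha : R) f g (z0 : H) (k : nat) : H :=
  iter k (dr_operator gamma alpha f g) z0.

End ExtendedFunctions.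

Definition dr_delta (R : realType) (gamma sigma beta : R) : R :=
  Num.max ((gamma * beta - 1) / (gamma * beta + 1))
          ((1 - gamma * sigma) / (1 + gamma * sigma)).

(* Main.v *)
Require Import Defs.
From HB Require Import structures.
From mathcomp Require Import all_boot all_order all_algebra.
From mathcomp Require Import all_classical all_reals all_analysis.
From mathcomp Require Import ring lra.

Import Order.TTheory GRing.Theory Num.Theory.
Import numFieldNormedType.Exports.

Set Implicit Arguments.
Unset Strict Implicit.

Local Open Scope classical_set_scope.
Local Open Scope ring_scope.

(** The rate is attained, and the range of step lengths is sharp, already for
    quadratics on the real line.

    The function [lambda / 2 * |x| ^ 2] has reflected resolvent
    [z |-> r lambda *: z] where [r lambda] is the Cayley transform
    [(1 - gamma * lambda) / (1 + gamma * lambda)].  Two choices of [g] then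
    reflect trivially: the zero function gives the identity, the indicator
    of the singleton [0] gives [- Id].  As [delta] is by definition either
    [r sigma] or [- r beta], taking [lambda] at the corresponding end of
    [sigma, beta] and the right one of these two [g] makes
    [R_g \o R_f = s * delta *: Id] with either sign [s = 1] or [s = -1] at will
    ([extremal_problem]).  The iteration is then the multiplication by
    [q = 1 - alpha + alpha * s * delta] ([dr_iter_homothety]).

    For the tightness of the rate, [s] is chosen so that the two parts of [q]
    have the same sign, namely [s = 1] if [alpha <= 1] and [s = -1] otherwise;
    then [|q| = |1 - alpha| + alpha * delta].

    For the failure of convergence, [s = -1] always works: [q] is
    [1 - alpha * (1 + delta)], and [|q| < 1] holds exactly when
    [0 < alpha < 2 / (1 + delta)].  Outside this range the norms of the
    iterates are bounded away from zero, whereas zero is the only minimizer of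
    [f + g].

    Everything but the differentiability of [f] is carried out in an arbitrary
    Hilbert space, where [normsq_comb] turns each inequality on norms into a
    polynomial identity. *)

(** * The real line as a Hilbert space *)

Section Line.
Context {R : realType}.

Definition line_dot (x y : R^o) : R := x * y.

Lemma line_dot_bilinear :
  bilinear_for ( *%R : R -> R -> R) (idfun \; *%R) line_dot.
Proof.
by split=> z a x y; rewrite /line_dot /= /GRing.scale /=; ring.
Qed.

HB.instance Definition _ := bilinear_isBilinear.Build R R^o R^o R
  ( *%R : R -> R -> R) (idfun \; *%R) line_dot line_dot_bilinear.

Lemma line_dot_sym (x y : R^o) :
  line_dot x y = (-1) ^+ false * idfun (line_dot y x).
Proof. by rewrite expr0 mul1r /line_dot mulrC. Qed.

HB.instance Definition _ := isHermitianSesquilinear.Build R R^o false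
  (idfun : R -> R) line_dot line_dot_sym.

Lemma line_dot_gt0 (x : R^o) : x != 0 -> 0 < line_dot x x.
Proof. by move=> x0; rewrite /line_dot -expr2 exprn_even_gt0. Qed.

HB.instance Definition _ := isDotProduct.Build R R^o line_dot line_dot_gt0.

Lemma line_dot_norm (x : R^o) : line_dot x x = `|x| ^+ 2.
Proof. by rewrite /line_dot real_normK ?num_real // expr2. Qed.

End Line.

Definition real_line (R : realType) : hilbertSpace R :=
  @HilbertSpace R (R^o : completeNormedModType R) line_dot line_dot_norm.

(** * Quadratics and the indicator of the origin *)

Section Hilbert.
Context {R : realType} {H : hilbertSpace R}.
Implicit Types (x y z : H) (c t lambda gamma : R).

Lemma normsq_comb (a b : R) x y :
  `|a *: x + b *: y| ^+ 2 =
  a ^+ 2 * `|x| ^+ 2 + b ^+ 2 * `|y| ^+ 2 + 2 * a * b * hilbert_dot H x y.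
Proof.
rewrite -!hilbert_dot_norm; set r := RHS.
rewrite !(linearDl, linearDr, linearZl, linearZr) /=.
rewrite (hermitian_subproof y x) expr0 mul1r /= /r; ring.
Qed.

(** A minimizer that beats every other point strictly is unique, which
    determines the value picked by choice in [prox]. *)
Lemma prox_eq gamma (h : H -> \bar R) z x :
  (forall y, y != x ->
    (gamma%:E * h x + (2^-1 * `|x - z| ^+ 2)%:E
       < gamma%:E * h y + (2^-1 * `|y - z| ^+ 2)%:E)%E) ->
  prox gamma h z = x.
Proof.
move=> xmin; apply: get_unique => [y|y ymin].
  by have [->|/xmin/ltW] := eqVneq y x.
by apply/eqP/negPn/negP => /xmin; rewrite ltNge (ymin x).
Qed.

Definition quadratic lambda x : \bar R := (lambda / 2 * `|x| ^+ 2)%:E.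

(** The convexity gap of the squared norm is [t * (1 - t) * |x - y| ^ 2]. *)
Lemma convex_normsq c : 0 <= c -> convex_fun (fun x => (c * `|x| ^+ 2)%:E).
Proof.
move=> c0 x y t /andP[t0 t1]; rewrite -!EFinM -EFinD lee_fin normsq_comb.
have := normsq_comb 1 (-1) x y.
have := sqr_ge0 `|1 *: x + (-1) *: y|; set d := (_ ^+ 2) => d0 dE.
rewrite -subr_ge0 (_ : _ - _ = c * (t * (1 - t)) * d).
  by rewrite !mulr_ge0 // subr_ge0.
by rewrite dE; ring.
Qed.

Lemma convex_quadratic lambda : 0 <= lambda -> convex_fun (quadratic lambda).
Proof. by move=> l0; apply: convex_normsq; rewrite divr_ge0. Qed.

Lemma continuous_normsq c : continuous (fun x => c * `|x| ^+ 2).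
Proof.
move=> x; apply: cvgM; first exact: cvg_cst.
by apply: cvgM; apply: cvg_norm; exact: cvg_id.
Qed.

Lemma closed_quadratic lambda : closed_fun (quadratic lambda).
Proof.
rewrite /closed_fun /quadratic.
rewrite (_ : mkset _ =
   (fun p : H * R => p.2 - lambda / 2 * `|p.1| ^+ 2) @^-1` [set r | 0 <= r]).
  apply: preimage_closed; last exact: (@closed_ge R 0).
  move=> p _; apply: cvgB; first exact: cvg_snd.
  apply: (@continuous_comp _ H R^o fst (fun x => lambda / 2 * `|x| ^+ 2) p).
    exact: cvg_fst.
  exact: continuous_normsq.
by apply/seteqP; split => p /=; rewrite lee_fin subr_ge0.
Qed.

Lemma resolvent_gt0 gamma lambda :
  0 < gamma -> 0 <= lambda -> 0 < 1 + gamma * lambda.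
Proof. by move=> g0 l0; rewrite ltr_wpDr // mulr_ge0 // ltW. Qed.

(** Writing [x] for the claimed value, the objective at [y] exceeds that at [x]
    by [(1 + gamma * lambda) / 2 * |y - x| ^ 2]. *)
Lemma prox_quadratic gamma lambda z : 0 < gamma -> 0 <= lambda ->
  prox gamma (quadratic lambda) z = (1 + gamma * lambda)^-1 *: z.
Proof.
move=> g0 l0; have D0 := resolvent_gt0 g0 l0.
set x := _ *: z; apply: prox_eq => y ynx.
rewrite /quadratic -!EFinM -!EFinD lte_fin.
have zE : z = (1 + gamma * lambda) *: x.
  by rewrite scalerA divff ?scale1r ?gt_eqF.
have normsq_sub (u : H) :
    `|u - z| ^+ 2 = `|1 *: u + (- (1 + gamma * lambda)) *: x| ^+ 2.
  by rewrite scale1r scaleNr -zE.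
have d0 : 0 < `|1 *: y + (-1) *: x| ^+ 2.
  by rewrite scale1r scaleN1r exprn_gt0 // normr_gt0 subr_eq0.
move: d0; rewrite !normsq_sub !normsq_comb hilbert_dot_norm => d0.
rewrite -subr_gt0; set e := (X in 0 < X).
rewrite (_ : e = (1 + gamma * lambda) / 2 *
    (1 ^+ 2 * `|y| ^+ 2 + (-1) ^+ 2 * `|x| ^+ 2 +
     2 * 1 * -1 * hilbert_dot H y x)); last by rewrite /e; field.
by rewrite mulr_gt0 // divr_gt0.
Qed.

Lemma reflected_quadratic gamma lambda z : 0 < gamma -> 0 <= lambda ->
  reflected_prox gamma (quadratic lambda) z =
  ((1 - gamma * lambda) / (1 + gamma * lambda)) *: z.
Proof.
move=> g0 l0; have D0 := resolvent_gt0 g0 l0.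
rewrite /reflected_prox prox_quadratic // scalerA -[X in _ - X]scale1r -scalerBl.
by congr (_ *: _); field; rewrite gt_eqF.
Qed.

Definition indicator0 x : \bar R := if x == 0 then 0%E else +oo%E.

Lemma proper_indicator0 : Defs.proper indicator0.
Proof.
split; first by move=> x; rewrite /indicator0; case: ifP.
by exists 0; rewrite /indicator0 eqxx.
Qed.

Lemma closed_indicator0 : closed_fun indicator0.
Proof.
rewrite /closed_fun (_ : mkset _ =
  (fst @^-1` [set 0 : H]) `&` (snd @^-1` [set r : R | 0 <= r])).
  apply: closedI; apply: preimage_closed.
  - by move=> p _; exact: cvg_fst.
  - exact/accessible_closed_set1/hausdorff_accessible/norm_hausdorff.
  - by move=> p _; exact: cvg_snd.
  - exact: (@closed_ge R 0).
apply/seteqP; split => -[x r] /=; rewrite /indicator0.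
  by case: eqP => // ->; rewrite lee_fin.
by move=> [-> r0]; rewrite eqxx lee_fin.
Qed.

(** When [t] is 0 or 1, the convention [0 * +oo = 0] makes the infinite value
    at the point of weight zero disappear, hence the case distinctions. *)
Lemma convex_indicator0 : convex_fun indicator0.
Proof.
move=> x y t /andP[t0 t1]; rewrite /indicator0.
have [->|xn0] := eqVneq x 0; have [->|yn0] := eqVneq y 0.
- by rewrite !scaler0 addr0 eqxx !mule0 adde0.
- have [->|tn1] := eqVneq t 1.
    by rewrite subrr scale0r addr0 scaler0 eqxx mule0 mul0e adde0.
  by rewrite mule0 add0e gt0_muley ?leey // lte_fin subr_gt0 lt_neqAle tn1.
- have [->|tn0] := eqVneq t 0.
    by rewrite scale0r add0r scaler0 eqxx mule0 mul0e adde0.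
  by rewrite mule0 adde0 gt0_muley ?leey // lte_fin lt_neqAle eq_sym tn0.
- have [->|tn0] := eqVneq t 0.
    by rewrite scale0r add0r subr0 scale1r (negPf yn0) mul0e add0e mul1e.
  rewrite gt0_muley ?lte_fin ?lt_neqAle 1?eq_sym ?tn0 // addye ?leey //.
  have [->|tn1] := eqVneq t 1; first by rewrite subrr mul0e.
  by rewrite gt0_muley // lte_fin subr_gt0 lt_neqAle tn1.
Qed.

Lemma prox_indicator0 gamma z : 0 < gamma -> prox gamma indicator0 z = 0.
Proof.
move=> g0; apply: prox_eq => y yn0.
rewrite /indicator0 eqxx (negPf yn0) mule0 add0e gt0_muley ?lte_fin //.
by rewrite addye // ltry.
Qed.

Lemma reflected_indicator0 gamma z :
  0 < gamma -> reflected_prox gamma indicator0 z = - z.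
Proof. by move=> g0; rewrite /reflected_prox prox_indicator0 // scaler0 sub0r. Qed.

Lemma proper_quadratic lambda : Defs.proper (quadratic lambda).
Proof. by split=> [x //|]; exists 0. Qed.

Lemma reflected_quadratic0 gamma z :
  0 < gamma -> reflected_prox gamma (quadratic 0) z = z.
Proof.
by move=> g0; rewrite reflected_quadratic // !mulr0 subr0 addr0 divr1 scale1r.
Qed.

(** * Problems on which the iteration is a homothety *)

Lemma dr_iter_homothety gamma alpha r (f g : H -> \bar R) z0 k :
  (forall z, pr_operator gamma f g z = r *: z) ->
  dr_iter gamma alpha f g z0 k = (1 - alpha + alpha * r) ^+ k *: z0.
Proof.
move=> prE; elim: k => [|k IH]; first by rewrite expr0 scale1r.
by rewrite exprS -scalerA -IH [LHS]iterS /dr_operator prE scalerA -scalerDl.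
Qed.

Lemma minimizer_quadraticD lambda (g : H -> \bar R) x :
  0 < lambda -> (forall y, (0 <= g y)%E) -> g 0 = 0%E ->
  minimizer (fun y => (quadratic lambda y + g y)%E) x -> x = 0.
Proof.
move=> l0 g_ge0 g00 /(_ 0); rewrite g00 /quadratic normr0 expr0n mulr0 adde0.
move=> fgx; apply/eqP; rewrite -normr_eq0 -(sqrf_eq0 `|x|) eq_le sqr_ge0 andbT.
rewrite -(pmulr_rle0 (x := lambda / 2)) ?divr_gt0 // -lee_fin.
exact: le_trans (leeDl _ (g_ge0 x)) fgx.
Qed.

Lemma geometric_not_cvg0 c q z0 : c != 0 -> 1 <= `|q| -> z0 != 0 ->
  ~ (c *: (q ^+ k *: z0) @[k --> \oo] --> (0 : H)).
Proof.
move=> c0 q1 z00 /cvgr0_norm_lt/(_ (`|c| * `|z0|)).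
rewrite mulr_gt0 ?normr_gt0 // => /(_ isT)[N _ /(_ N (leqnn N))]/=.
rewrite !normrZ normrX ltNge ler_wpM2l // ler_peMl //.
by rewrite exprn_ege1.
Qed.

(** The ratio [delta] is, up to sign, the factor of the reflection of a
    quadratic whose curvature is an end of [sigma, beta].  The choice between
    the two functions [g], whose reflections are [Id] and [- Id], corrects or
    flips this sign.  The nonnegativity of [g] and [g 0 = 0] serve to locate
    the minimizers of the sum. *)
Lemma extremal_problem gamma sigma beta (b : bool) :
  0 < sigma -> sigma <= beta -> 0 < gamma ->
  exists lambda (g : H -> \bar R),
  [/\ sigma <= lambda <= beta,
      [/\ Defs.proper g, closed_fun g & convex_fun g],
      forall x, (0 <= g x)%E,
      g 0 = 0%E
    & forall z, pr_operator gamma (quadratic lambda) g z =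
                ((-1) ^+ b * dr_delta gamma sigma beta) *: z].
Proof.
move=> s0 sb g0.
have [lambda [c [lambdaP deltaE]]] : exists lambda (c : bool),
    sigma <= lambda <= beta /\ dr_delta gamma sigma beta =
      (-1) ^+ c * ((1 - gamma * lambda) / (1 + gamma * lambda)).
  rewrite /dr_delta; case: (leP ((gamma * beta - 1) / (gamma * beta + 1))) => _.
    by exists sigma, false; rewrite lexx sb expr0 mul1r.
  exists beta, true; rewrite lexx sb expr1 mulN1r -mulNr opprB.
  by rewrite [1 + _]addrC.
have l0 : 0 <= lambda by case/andP: lambdaP => sl _; rewrite (le_trans (ltW s0)).
have signE : (-1) ^+ b * dr_delta gamma sigma beta =
    (-1) ^+ (b (+) c) * ((1 - gamma * lambda) / (1 + gamma * lambda)).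
  by rewrite deltaE mulrA -signr_addb.
exists lambda; rewrite signE /pr_operator; case: (b (+) c).
- exists indicator0; split=> //.
  + split; [exact: proper_indicator0|exact: closed_indicator0|].
    exact: convex_indicator0.
  + by move=> x; rewrite /indicator0; case: ifP.
  + by rewrite /indicator0 eqxx.
  + move=> z /=; rewrite reflected_indicator0 // reflected_quadratic //.
    by rewrite expr1 mulN1r scaleNr.
- exists (quadratic 0); split=> //.
  + split; [exact: proper_quadratic|exact: closed_quadratic|].
    exact: convex_quadratic.
  + by move=> x; rewrite /quadratic !mul0r.
  + by rewrite /quadratic !mul0r.
  + move=> z /=; rewrite reflected_quadratic0 // reflected_quadratic //.
    by rewrite expr0 mul1r.
Qed.

End Hilbert.

(** The functions that have to be convex here are again multiples of the squared
    norm, with coefficients [(lambda - sigma) / 2] and [(beta - lambda) / 2]. *)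
Lemma quadratic_dr_class (R : realType) (sigma beta lambda : R)
    (g : real_line R -> \bar R) :
  0 < sigma -> sigma <= lambda <= beta ->
  [/\ Defs.proper g, closed_fun g & convex_fun g] ->
  dr_class sigma beta (quadratic lambda) g.
Proof.
move=> s0 /andP[sl lb] gP; split => //.
- split; [exact: proper_quadratic|exact: closed_quadratic|].
  by apply: convex_quadratic; rewrite (le_trans (ltW s0)).
- rewrite /strongly_convex (_ : (fun x => _) =
    (fun x => ((lambda - sigma) / 2 * `|x| ^+ 2)%:E)).
    by apply: convex_normsq; rewrite divr_ge0 // subr_ge0.
  by apply/funext => x; rewrite /quadratic -EFinB; congr (_%:E); ring.
- split=> [x //|x|].
  + have -> : fine \o (quadratic (H := real_line R) lambda) =
      (fun y : R^o => (lambda / 2) *: (y ^+ 2 : R^o)).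
      apply/funext => y /=; rewrite -[`|y|%R ^+ 2](line_dot_norm (y : R^o)).
      by rewrite /line_dot -expr2.
    exact: differentiableZ.
  + rewrite (_ : (fun x => _) =
      (fun x => ((beta - lambda) / 2 * `|x| ^+ 2)%:E)).
      by apply: convex_normsq; rewrite divr_ge0 // subr_ge0.
    by apply/funext => x; rewrite /quadratic -EFinB; congr (_%:E); ring.
Qed.

(** The first term of the maximum is nonnegative as soon as [gamma * beta >= 1],
    the second one as soon as [gamma * sigma <= 1]. *)
Lemma dr_delta_ge0 (R : realType) (gamma sigma beta : R) :
  0 < sigma -> sigma <= beta -> 0 < gamma -> 0 <= dr_delta gamma sigma beta.
Proof.
move=> s0 sb g0; rewrite /dr_delta le_max.
have gs0 := mulr_gt0 g0 s0.
have gsb : gamma * sigma <= gamma * beta by rewrite ler_pM2l.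
have [?|?] := leP (gamma * sigma) 1.
  by apply/orP; right; apply: divr_ge0; lra.
by apply/orP; left; apply: divr_ge0; lra.
Qed.

Unset Implicit Arguments.

(** * Sharpness of the rate and of the range of step lengths *)

Theorem theorem3 (R : realType) (sigma beta gamma : R)
    (sigma_gt0 : 0 < sigma) (sigma_le_beta : sigma <= beta)
    (gamma_gt0 : 0 < gamma) :
  let delta := dr_delta gamma sigma beta in
  (forall alpha : R, 0 < alpha < 2 / (1 + delta) ->
     exists (H : hilbertSpace R) (f g : H -> \bar R) (zbar z0 : H),
       [/\ dr_class sigma beta f g,
           pr_operator gamma f g zbar = zbar,
           z0 != zbar
         & forall k : nat,
             `|dr_iter gamma alpha f g z0 k.+1 - zbar| =
             (`|1 - alpha| + alpha * delta) *
               `|dr_iter gamma alpha f g z0 k - zbar|]) /\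
  (forall alpha : R, ~~ (0 < alpha < 2 / (1 + delta)) ->
     exists (H : hilbertSpace R) (f g : H -> \bar R) (z0 : H),
       dr_class sigma beta f g /\
       ~ (exists xstar : H,
            minimizer (fun x => (f x + g x)%E) xstar /\
            prox gamma f (dr_iter gamma alpha f g z0 k) @[k --> \oo]
              --> xstar)).
Proof.
move=> delta.
have delta0 : 0 <= delta by exact: dr_delta_ge0.
split=> alpha.
- move=> /andP[a0 _].
  (* The sign of [R_g \o R_f] is that of [1 - alpha], so that the two terms of
     the factor of the iteration do not cancel. *)
  have [lambda [g [lambdaP gP _ _ prE]]] := @extremal_problem R (real_line R)
    gamma sigma beta (1 < alpha) sigma_gt0 sigma_le_beta gamma_gt0.
  exists (real_line R), (quadratic lambda), g, 0, ((1 : R^o) : real_line R); split.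
  + exact: quadratic_dr_class.
  + by rewrite prE scaler0.
  + exact: oner_neq0.
  + move=> k; rewrite !subr0 !(dr_iter_homothety _ _ _ prE) exprS -scalerA normrZ.
    congr (_ * _); rewrite -/delta.
    have [a1|a1] := ltP 1 alpha.
      rewrite expr1 ler0_norm ?(ltr0_norm (x := 1 - alpha)); first by ring.
        by rewrite subr_lt0.
      by have := mulr_ge0 (ltW a0) delta0; lra.
    rewrite expr0 mul1r !ger0_norm ?subr_ge0 // addr_ge0 ?subr_ge0 //.
    by rewrite mulr_ge0 // ltW.
- move=> alphaP.
  have [lambda [g [lambdaP gP g_ge0 g00 prE]]] := @extremal_problem R (real_line R)
    gamma sigma beta true sigma_gt0 sigma_le_beta gamma_gt0.
  have l0 : 0 < lambda by case/andP: lambdaP => sl _; exact: lt_le_trans sl.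
  exists (real_line R), (quadratic lambda), g, ((1 : R^o) : real_line R).
  split=> [|[x [xmin]]]; first exact: quadratic_dr_class.
  rewrite (minimizer_quadraticD l0 g_ge0 g00 xmin).
  under eq_fun do rewrite prox_quadratic ?ltW // (dr_iter_homothety _ _ _ prE).
  apply: geometric_not_cvg0; last exact: oner_neq0.
    by rewrite invr_eq0 gt_eqF // resolvent_gt0 // ltW.
  rewrite -/delta expr1 mulN1r mulrN ler_normr.
  have D0 : 0 < 1 + delta by rewrite ltr_pwDl.
  have [a0|a0] := leP alpha 0.
    have : alpha * (1 + delta) <= 0 by rewrite mulr_le0_ge0 // ltW.
    by move=> ?; apply/orP; left; lra.
  move: alphaP; rewrite a0 /= -leNgt ler_pdivrMr // => ?.
  by apply/orP; right; lra.
Qed.
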